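(* The linear map $L:\mathbb Z\mathbf{DS}\to\mathbb ZS$, sending each special double poset to the sum of its linear extensions, preserves the scalar product and the internal product: for all $x,y\in\mathbb Z\mathbf{DS}$, $$\langle x,y\rangle=(L(x),L(y))\qquad\text{and}\qquad L(x\circ y)=L(x)\circ L(y),$$ where $\langle\,,\rangle$ is the Zelevinsky scalar product and $x\circ y$ the internal product on $\mathbb Z\mathbf{DS}$, and where $(\,,)$ is the Jöllenbeck scalar product and $L(x)\circ L(y)$ the internal product on $\mathbb ZS$.
   Context: A double poset is a triple $(E,<_1,<_2)$, where $E$ is a finite set and $<_1,<_2$ are two (strict) partial orders on $E$, called the first and second order. Isomorphic double posets (via a bijection that is an isomorphism for both orders) are identified. A double poset is special if its second order is total. $\mathbb Z\mathbf{DS}$ is the free $\mathbb Z$-module on the (isomorphism classes of) special double posets. Zelevinsky scalar product: a picture from $E$ to $F$ is a bijection $\phi:E\to F$ such that $e<_1e'$ implies $\phi(e)<_2\phi(e')$ and $f<_1f'$ implies $\phi^{-1}(f)<_2\phi^{-1}(f')$. The pairing $\langle\,,\rangle$ is the bilinear extension of $\langle E,F\rangle=$ the number of pictures from $E$ to $F$. Internal product of double posets: for a bijection $\phi:E\to F$ that is increasing $(E,<_1)\to(F,<_2)$ (i.e. $e<_1e'\Rightarrow\phi(e)<_2\phi(e')$), let $E\times_\phi F=\{(e,f)\in E\times F:\phi(e)=f\}$, which is a double poset with $(e,f)<_1(e',f')$ iff $f<_1f'$ in $F$, and $(e,f)<_2(e',f')$ iff $e<_2e'$ in $E$. Then $E\circ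 F$ is the sum of the double posets $E\times_\phi F$ over all increasing bijections $\phi:(E,<_1)\to(F,<_2)$ (the sum is $0$ if there are none), extended bilinearly. If $E$ and $F$ are special, each $E\times_\phi F$ is special. Linear extensions: for a special double poset $\pi=(E,<_1,<_2)$ with $|E|=n$, its labelling $\omega$ is the unique order isomorphism $(E,<_2)\to\{1,\dots,n\}$. A linear extension of $\pi$ is a permutation $\sigma\in S_n$ such that $\sigma^{-1}\circ\omega$ is an increasing bijection $(E,<_1)\to\{1,\dots,n\}$. The map $L$ is defined linearly by $L(\pi)=\sum\sigma$, over all linear extensions $\sigma$ of $\pi$. $\mathbb ZS=\bigoplus_{n\ge0}\mathbb ZS_n$. The Jöllenbeck scalar product on $\mathbb ZS$ is the bilinear form with, for permutations $\sigma,\tau$, $(\sigma,\tau)=1$ if $\sigma=\tau^{-1}$ and $0$ otherwise. The internal product on $\mathbb ZS$ is the bilinear product extending composition of permutations $\sigma\circ\tau$ (with $(\sigma\circ\tau)(i)=\sigma(\tau(i))$) in each $S_n$, the product of permutations in $S_n$ and $S_m$ with $n\neq m$ being $0$. *)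

(* Defs.v *)
From HB Require Import structures.
From mathcomp Require Import all_boot all_order all_fingroup all_algebra.
From mathcomp Require Import generic_quotient.
From mathcomp.multinomials Require Export freeg.

Set Implicit Arguments.
Unset Strict Implicit.
Unset Printing Implicit Defensive.

Import GRing.Theory.
Local Open Scope ring_scope.

(* A bijection between finite types, stored together with its inverse. *)
Section Bijections.
Variables T U : finType.

Record bij := Bij {
  bij_pair : {ffun T -> U} * {ffun U -> T};
  _ : [forall x, bij_pair.2 (bij_pair.1 x) == x]
      && [forall y, bij_pair.1 (bij_pair.2 y) == y] }.

HB.instance Definition _ := [isSub for bij_pair].
HB.instance Definition _ := [Finite of bij by <:].

Definition bij_fun (f : bij) : T -> U := (val f).1.
Coercion bij_fun : bij >-> Funclass.
Definition bij_inv (f : bij) : U -> T := (val f).2.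

Lemma bijK (f : bij) : cancel f (bij_inv f).
Proof. by move=> x; case/andP: (valP f) => /forallP/(_ x)/eqP. Qed.

Lemma bijVK (f : bij) : cancel (bij_inv f) f.
Proof. by move=> y; case/andP: (valP f) => _ /forallP/(_ y)/eqP. Qed.

Lemma bij_inj (f : bij) : injective f.
Proof. exact: can_inj (bijK f). Qed.

Fact mkbij_subproof (f : T -> U) (g : U -> T) (fK : cancel f g)
    (gK : cancel g f) (p := ([ffun x => f x], [ffun y => g y])) :
  [forall x, p.2 (p.1 x) == x] && [forall y, p.1 (p.2 y) == y].
Proof.
by apply/andP; split; apply/forallP=> x; rewrite /= !ffunE ?fK ?gK.
Qed.
Definition mkbij f g fK gK : bij := Bij (@mkbij_subproof f g fK gK).

Lemma mkbijE f g fK gK x : @mkbij f g fK gK x = f x.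
Proof. exact: ffunE. Qed.

Lemma mkbijVE f g fK gK y : bij_inv (@mkbij f g fK gK) y = g y.
Proof. exact: ffunE. Qed.

Lemma bij_ext (f g : bij) : f =1 g -> f = g.
Proof.
move=> fg; apply: val_inj; rewrite [LHS]surjective_pairing.
rewrite [RHS]surjective_pairing; congr pair; apply/ffunP=> x; first exact: fg.
by apply: (@bij_inj f); rewrite [LHS](bijVK f) fg [RHS](bijVK g).
Qed.

Definition increasing (r : rel T) (s : rel U) (f : T -> U) : bool :=
  [forall x, forall x', r x x' ==> s (f x) (f x')].

Lemma increasingP (r : rel T) (s : rel U) (f : T -> U) :
  reflect (forall x x', r x x' -> s (f x) (f x')) (increasing r s f).
Proof.
apply: (iffP forallP) => [h x x'|h x]; first by move/forallP: (h x) => /(_ x')/implyP.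
by apply/forallP=> x'; apply/implyP; apply: h.
Qed.

End Bijections.

Definition bij_sym (T U : finType) (f : bij T U) : bij U T :=
  mkbij (bijVK f) (bijK f).

Lemma bij_symE (T U : finType) (f : bij T U) y : bij_sym f y = bij_inv f y.
Proof. exact: mkbijE. Qed.

Definition bij_comp (T U V : finType) (f : bij T U) (g : bij U V) : bij T V :=
  mkbij (can_comp (bijK g) (bijK f)) (can_comp (bijVK f) (bijVK g)).

Lemma bij_compE (T U V : finType) (f : bij T U) (g : bij U V) x :
  bij_comp f g x = g (f x).
Proof. exact: mkbijE. Qed.

Lemma bij_card (T U : finType) (f : bij T U) : #|T| = #|U|.
Proof.
apply/eqP; rewrite eqn_leq (leq_card f) ?(leq_card (bij_inv f)) //.
  exact: can_inj (bijVK f).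
exact: bij_inj.
Qed.

Section DoublePosets.
Variable T : finType.

Definition strict_order (r : rel T) : bool :=
  [forall x, ~~ r x x]
  && [forall x, forall y, forall z, r x y ==> r y z ==> r x z].

Lemma strict_orderP (r : rel T) :
  reflect (irreflexive r /\ transitive r) (strict_order r).
Proof.
apply: (iffP andP) => [[/forallP h /forallP k]|[h k]]; split.
- by move=> x; apply/negbTE.
- move=> y x z; move/forallP: (k x) => /(_ y)/forallP/(_ z)/implyP h1 h2 h3.
  exact: (implyP (h1 h2)).
- by apply/forallP=> x; rewrite h.
- apply/forallP=> x; apply/forallP=> y; apply/forallP=> z.
  by apply/implyP=> xy; apply/implyP; apply: k.
Qed.

Definition strict_total (r : rel T) : bool :=
  [forall x, forall y, (x != y) ==> (r x y || r y x)].

Lemma strict_totalP (r : rel T) :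
  reflect (forall x y, x != y -> r x y || r y x) (strict_total r).
Proof.
apply: (iffP forallP) => [h x y|h x]; first by move/forallP: (h x) => /(_ y)/implyP.
by apply/forallP=> y; apply/implyP; apply: h.
Qed.

(* The orders are stored as finite functions (and not as functions T -> T ->   *)
(* bool) so that double posets on T form a finite, hence choice, type.         *)
Record dposet := DPoset {
  dp_rels : {ffun T * T -> bool} * {ffun T * T -> bool};
  _ : strict_order (fun x y => dp_rels.1 (x, y))
      && strict_order (fun x y => dp_rels.2 (x, y)) }.

HB.instance Definition _ := [isSub for dp_rels].
HB.instance Definition _ := [Finite of dposet by <:].

Definition lt1 (P : dposet) : rel T := fun x y => (val P).1 (x, y).
Definition lt2 (P : dposet) : rel T := fun x y => (val P).2 (x, y).

Lemma lt1_order P : strict_order (lt1 P).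
Proof. by case/andP: (valP P). Qed.

Lemma lt2_order P : strict_order (lt2 P).
Proof. by case/andP: (valP P). Qed.

Definition special (P : dposet) : bool := strict_total (lt2 P).

Record sdposet := SDPoset { sd_dposet :> dposet; _ : special sd_dposet }.

HB.instance Definition _ := [isSub for sd_dposet].
HB.instance Definition _ := [Finite of sdposet by <:].

Lemma eq_strict_order (r s : rel T) : r =2 s -> strict_order r = strict_order s.
Proof.
move=> rs; apply/strict_orderP/strict_orderP=> -[h k]; split.
- by move=> x; rewrite -rs.
- by move=> x y z; rewrite -!rs; apply: k.
- by move=> x; rewrite rs.
- by move=> x y z; rewrite !rs; apply: k.
Qed.

Fact mkdp_subproof (r s : rel T) (hr : strict_order r) (hs : strict_order s)
    (p := ([ffun z : T * T => r z.1 z.2], [ffun z : T * T => s z.1 z.2])) :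
  strict_order (fun x y => p.1 (x, y)) && strict_order (fun x y => p.2 (x, y)).
Proof.
rewrite (@eq_strict_order _ r) ?hr => [|x y]; last by rewrite /= ffunE.
by rewrite (@eq_strict_order _ s) ?hs => [|x y]; last by rewrite /= ffunE.
Qed.
Definition mkdp r s hr hs : dposet := DPoset (@mkdp_subproof r s hr hs).

Lemma lt1_mkdp r s hr hs : lt1 (@mkdp r s hr hs) =2 r.
Proof. by move=> x y; rewrite /lt1 ffunE. Qed.

Lemma lt2_mkdp r s hr hs : lt2 (@mkdp r s hr hs) =2 s.
Proof. by move=> x y; rewrite /lt2 ffunE. Qed.

Fact mksdp_subproof r s hr hs (ht : strict_total s) : special (@mkdp r s hr hs).
Proof.
by apply/strict_totalP=> x y; rewrite !lt2_mkdp; move/strict_totalP: ht; apply.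
Qed.
Definition mksdp r s hr hs ht : sdposet := SDPoset (@mksdp_subproof r s hr hs ht).

End DoublePosets.

Section Pullback.
Variables (T U : finType) (g : U -> T).

Lemma pull_order (r : rel T) : strict_order r -> strict_order (relpre g r).
Proof.
case/strict_orderP=> h k; apply/strict_orderP; split=> [x|y x z] /=.
  exact: h.
exact: k.
Qed.

Lemma pull_total (r : rel T) :
  injective g -> strict_total r -> strict_total (relpre g r).
Proof.
by move=> gI /strict_totalP h; apply/strict_totalP=> x y xy; rewrite h ?inj_eq.
Qed.

Definition transport (gI : injective g) (P : sdposet T) : sdposet U :=
  mksdp (pull_order (lt1_order P)) (pull_order (lt2_order P))
        (pull_total gI (valP P)).

End Pullback.

Definition is_iso (T U : finType) (P : dposet T) (Q : dposet U) (f : bij T U) :=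
  [forall x, forall y, (lt1 Q (f x) (f y) == lt1 P x y)
                       && (lt2 Q (f x) (f y) == lt2 P x y)].

Definition iso (T U : finType) (P : dposet T) (Q : dposet U) : bool :=
  [exists f : bij T U, is_iso P Q f].

Lemma isoP (T U : finType) (P : dposet T) (Q : dposet U) :
  reflect (exists2 f : bij T U, (forall x y, lt1 Q (f x) (f y) = lt1 P x y)
             & (forall x y, lt2 Q (f x) (f y) = lt2 P x y)) (iso P Q).
Proof.
apply: (iffP existsP) => [[f /forallP h]|[f h1 h2]]; exists f.
- by move=> x y; case/andP: (forallP (h x) y) => /eqP.
- by move=> x y; case/andP: (forallP (h x) y) => _ /eqP.
- by do 2!apply/forallP=> ?; rewrite h1 h2 !eqxx.
Qed.

Lemma iso_refl (T : finType) (P : dposet T) : iso P P.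
Proof.
apply/isoP; exists (@mkbij T T id id (fun=> erefl) (fun=> erefl)) => x y;
by rewrite !mkbijE.
Qed.

Lemma iso_sym (T U : finType) (P : dposet T) (Q : dposet U) :
  iso P Q -> iso Q P.
Proof.
case/isoP=> f h1 h2; apply/isoP; exists (bij_sym f) => x y;
by rewrite !bij_symE -?h1 -?h2 !bijVK.
Qed.

Lemma iso_trans (T U V : finType) (P : dposet T) (Q : dposet U) (S : dposet V) :
  iso P Q -> iso Q S -> iso P S.
Proof.
case/isoP=> f h1 h2 /isoP[g k1 k2]; apply/isoP.
exists (bij_comp f g) => x y;
by rewrite !bij_compE ?k1 ?k2 ?h1 ?h2.
Qed.

(* DS is the type of isomorphism classes of special double posets: since every *)
(* finite set is in bijection with some 'I_n, it is built as a quotient of the *)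
(* special double posets carried by the 'I_n, and "cls" sends a special double *)
(* poset on an arbitrary finite type to its class (see clsP).                  *)
Definition skel := {n : nat & sdposet 'I_n}.
HB.instance Definition _ := Choice.on skel.

Definition iso_skel (p q : skel) : bool := iso (tagged p) (tagged q).

Fact iso_skel_refl : reflexive iso_skel.
Proof. by move=> p; apply: iso_refl. Qed.
Fact iso_skel_sym : symmetric iso_skel.
Proof. by move=> p q; apply/idP/idP; apply: iso_sym. Qed.
Fact iso_skel_trans : transitive iso_skel.
Proof. by move=> q p r; apply: iso_trans. Qed.

Canonical iso_skel_equiv :=
  EquivRel iso_skel iso_skel_refl iso_skel_sym iso_skel_trans.
Canonical iso_skel_encModRel := defaultEncModRel iso_skel.

Definition DS := {eq_quot iso_skel}%qT.
HB.instance Definition _ := Choice.on DS.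
HB.instance Definition _ := EqQuotient.on DS.

Definition cls (T : finType) (P : sdposet T) : DS :=
  \pi_DS%qT (Tagged (fun n => sdposet 'I_n)
               (transport (@enum_val_inj T predT) P)) .

Definition rep (c : DS) : sdposet 'I_(tag (repr c)) := tagged (repr c).

Definition enum_bij (T : finType) : bij 'I_#|T| T :=
  mkbij (@enum_valK T) (@enum_rankK T).

Lemma rep_cls (T : finType) (P : sdposet T) : iso P (rep (cls P)).
Proof.
have : iso_skel (repr (cls P)) (Tagged _ (transport (@enum_val_inj T predT) P)).
  by apply/eqmodP; rewrite reprK.
rewrite iso_skel_sym; apply: iso_trans.
apply: iso_sym; apply/isoP.
by exists (enum_bij T) => x y; rewrite !mkbijE (lt1_mkdp, lt2_mkdp).
Qed.

Lemma clsP (T U : finType) (P : sdposet T) (Q : sdposet U) :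
  reflect (cls P = cls Q) (iso P Q).
Proof.
apply: (iffP idP) => [h|h]; last first.
  by apply: iso_trans (rep_cls P) _; rewrite h; apply/iso_sym/rep_cls.
rewrite -[LHS]reprK -[RHS]reprK; apply/eqmodP.
apply: iso_trans (rep_cls Q); apply: iso_trans h.
exact/iso_sym/rep_cls.
Qed.

Lemma repK (c : DS) : cls (rep c) = c.
Proof.
rewrite -[LHS]reprK -[RHS]reprK; apply/eqmodP.
exact/iso_sym/rep_cls.
Qed.

Definition ZDS := {freeg DS / int}.

(* The direct sum of the Z S_n, as the free Z-module on the disjoint union of  *)
(* the S_n; permutations act on 'I_n = {0, ..., n - 1}.                        *)
Definition ZS := {freeg {n : nat & 'S_n} / int}.

Definition permT (n : nat) (s : 'S_n) : {n : nat & 'S_n} := Tagged (fun n => 'S_n) s.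

Definition bilin (K1 K2 : choiceType) (M : lmodType int) (f : K1 -> K2 -> M)
    (x : {freeg K1 / int}) (y : {freeg K2 / int}) : M :=
  fglift (fun k1 => fglift (f k1) y) x.

Definition is_picture (T U : finType) (P : dposet T) (Q : dposet U)
    (f : bij T U) : bool :=
  increasing (lt1 P) (lt2 Q) f && increasing (lt1 Q) (lt2 P) (bij_inv f).

Definition npictures (T U : finType) (P : dposet T) (Q : dposet U) : nat :=
  #|[set f : bij T U | is_picture P Q f]|.

Definition zelevinsky (x y : ZDS) : int :=
  bilin (M := int^o) (fun c d => (npictures (rep c) (rep d))%:Z) x y.

Definition graph_of (T U : finType) (f : bij T U) := {p : T * U | f p.1 == p.2}.
HB.instance Definition _ (T U : finType) (f : bij T U) := Finite.on (graph_of f).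

Definition gfst (T U : finType) (f : bij T U) (p : graph_of f) : T := (val p).1.
Definition gsnd (T U : finType) (f : bij T U) (p : graph_of f) : U := (val p).2.

Lemma gsndE (T U : finType) (f : bij T U) (p : graph_of f) : gsnd p = f (gfst p).
Proof. exact/esym/eqP/(valP p). Qed.

Lemma gfst_inj (T U : finType) (f : bij T U) : injective (@gfst T U f).
Proof.
move=> p q pq; apply: val_inj; rewrite [LHS]surjective_pairing.
rewrite [RHS]surjective_pairing; congr pair => //.
by rewrite -!/(gsnd _) !gsndE pq.
Qed.

Definition fprod (T U : finType) (P : sdposet T) (Q : sdposet U) (f : bij T U) :
    sdposet (graph_of f) :=
  mksdp (pull_order (@gsnd T U f) (lt1_order Q))
        (pull_order (@gfst T U f) (lt2_order P))
        (pull_total (@gfst_inj T U f) (valP P)).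

Definition iprod (T U : finType) (P : sdposet T) (Q : sdposet U) : ZDS :=
  \sum_(f : bij T U | increasing (lt1 P) (lt2 Q) f) << cls (fprod P Q f) >>.

Definition zds_mul (x y : ZDS) : ZDS :=
  bilin (fun c d => iprod (rep c) (rep d)) x y.

(* A bijection w can only exist when n = #|T|. *)
Definition is_labelling (T : finType) (P : sdposet T) (n : nat) (w : bij T 'I_n) :
    bool :=
  [forall x, forall y, lt2 P x y == (w x < w y)%N].

Section Labelling.
Variables (T : finType) (P : sdposet T).

Let rank x := #|[set y | lt2 P y x]|.

Lemma labelling_rank n (w : bij T 'I_n) :
  is_labelling P w -> forall x, val (w x) = rank x.
Proof.
move=> /forallP hw x; rewrite /rank -(card_imset _ (@bij_inj _ _ w)).
transitivity #|[set i : 'I_n | (i < w x)%N]|.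
  rewrite -sum1_card; under eq_bigl do rewrite inE.
  by rewrite big_ord_narrow ?sum1_card ?card_ord // ltnW.
apply: eq_card => i; rewrite -[i](bijVK w) mem_imset ?inE; last exact: bij_inj.
by move/forallP: (hw (bij_inv w i)) => /(_ x)/eqP ->.
Qed.

Lemma labelling_uniq n (v w : bij T 'I_n) :
  is_labelling P v -> is_labelling P w -> v = w.
Proof.
move=> hv hw; apply: bij_ext => x; apply: val_inj.
by rewrite /= (labelling_rank hv) (labelling_rank hw).
Qed.

Lemma labelling_exists : exists w : bij T 'I_#|T|, is_labelling P w.
Proof.
have [irr tr] := strict_orderP _ (lt2_order P).
have lt_rank x y : lt2 P x y -> (rank x < rank y)%N.
  move=> xy; apply: proper_card; apply/properP; split.
    by apply/subsetP=> z; rewrite !inE => /tr; apply.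
  by exists x; rewrite !inE ?irr.
have rank_ltn x : (rank x < #|T|)%N.
  rewrite -cardsT; apply: proper_card; apply/properP; split.
    exact: subsetT.
  by exists x; rewrite !inE ?irr.
have rankE x y : lt2 P x y = (rank x < rank y)%N.
  apply/idP/idP=> [|xy]; first exact: lt_rank.
  have /strict_totalP tot := valP P.
  case: (eqVneq x y) xy => [->|/tot/orP[//|/lt_rank yx]]; first by rewrite ltnn.
  by rewrite ltnNge (ltnW yx).
have inj : injective (fun x => Ordinal (rank_ltn x)).
  move=> x y /(congr1 val) /= xy; apply/eqP; apply: contraT.
  have /strict_totalP tot := valP P.
  by move/tot; rewrite !rankE xy ltnn.
have [|g fK gK] := inj_card_bij inj; first by rewrite card_ord.
exists (mkbij fK gK); apply/forallP=> x; apply/forallP=> y.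
by rewrite !mkbijE rankE.
Qed.

End Labelling.

Definition linext (T : finType) (P : sdposet T) (n : nat) (s : 'S_n) : bool :=
  [exists w : bij T 'I_n,
    is_labelling P w &&
    increasing (lt1 P) (fun i j : 'I_n => (i < j)%N) (fun x => s^-1%g (w x))].

Definition Lgen (T : finType) (P : sdposet T) : ZS :=
  \sum_(s : 'S_#|T| | linext P s) << permT s >>.

Definition L (x : ZDS) : ZS := fglift (fun c => Lgen (rep c)) x.

Definition jollenbeck (x y : ZS) : int :=
  bilin (M := int^o)
    (fun s t : {n : nat & 'S_n} => (s == permT (tagged t)^-1%g)%:R) x y.

(* The product t * s of MathComp permutations is i |-> s (t i).                *)
Definition perm_comp (s t : {n : nat & 'S_n}) : ZS :=
  if tag s == tag t then << permT (tagged_as s t * tagged s)%g >> else 0.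

Definition zs_mul (x y : ZS) : ZS := bilin perm_comp x y.

(* The operations on classes are computed on arbitrary representatives. *)
Section WellDefined.
Variables (T T' U U' : finType).
Variables (P : sdposet T) (P' : sdposet T') (Q : sdposet U) (Q' : sdposet U').

Section Conj.
Variables (a : bij T T') (b : bij U U').
Hypothesis a1 : forall x y, lt1 P' (a x) (a y) = lt1 P x y.
Hypothesis a2 : forall x y, lt2 P' (a x) (a y) = lt2 P x y.
Hypothesis b1 : forall x y, lt1 Q' (b x) (b y) = lt1 Q x y.
Hypothesis b2 : forall x y, lt2 Q' (b x) (b y) = lt2 Q x y.

Definition bij_conj (f : bij T U) : bij T' U' :=
  bij_comp (bij_comp (bij_sym a) f) b.

Definition bij_unconj (f : bij T' U') : bij T U :=
  bij_comp (bij_comp a f) (bij_sym b).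

Lemma bij_conjE f x : bij_conj f (a x) = b (f x).
Proof. by rewrite !bij_compE bij_symE bijK. Qed.

Lemma bij_conjVE f y : bij_inv (bij_conj f) (b y) = a (bij_inv f y).
Proof.
by apply: (@bij_inj _ _ (bij_conj f)); rewrite bijVK bij_conjE bijVK.
Qed.

Lemma bij_conjK : cancel bij_conj bij_unconj.
Proof.
by move=> f; apply: bij_ext => x; rewrite !bij_compE !bij_symE !bijK.
Qed.

Lemma bij_unconjK : cancel bij_unconj bij_conj.
Proof.
by move=> f; apply: bij_ext => x; rewrite !bij_compE !bij_symE !bijVK.
Qed.

Lemma increasing_conj f :
  increasing (lt1 P') (lt2 Q') (bij_conj f) = increasing (lt1 P) (lt2 Q) f.
Proof.
apply/increasingP/increasingP=> h x y; first by rewrite -a1 -b2 -!bij_conjE; apply: h.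
by rewrite -[x](bijVK a) -[y](bijVK a) a1 !bij_conjE b2; apply: h.
Qed.

Lemma increasing_conjV f :
  increasing (lt1 Q') (lt2 P') (bij_inv (bij_conj f))
  = increasing (lt1 Q) (lt2 P) (bij_inv f).
Proof.
apply/increasingP/increasingP=> h x y; first by rewrite -b1 -a2 -!bij_conjVE; apply: h.
by rewrite -[x](bijVK b) -[y](bijVK b) b1 !bij_conjVE a2; apply: h.
Qed.

Lemma npictures_conj : npictures P Q = npictures P' Q'.
Proof.
rewrite /npictures -(card_imset _ (can_inj bij_conjK)); apply: eq_card => f.
rewrite -[f]bij_unconjK mem_imset ?inE; last exact: can_inj bij_conjK.
by rewrite /is_picture increasing_conj increasing_conjV.
Qed.

Fact gconj_subproof f (p : graph_of f) :
  bij_conj f (a (gfst p)) == b (gsnd p).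
Proof. by rewrite bij_conjE gsndE. Qed.

Definition gconj f (p : graph_of f) : graph_of (bij_conj f) :=
  exist _ (a (gfst p), b (gsnd p)) (gconj_subproof p).

Fact gunconj_subproof f (p : graph_of (bij_conj f)) :
  f (bij_inv a (gfst p)) == bij_inv b (gsnd p).
Proof.
by apply/eqP/(@bij_inj _ _ b); rewrite -bij_conjE !bijVK gsndE.
Qed.

Definition gunconj f (p : graph_of (bij_conj f)) : graph_of f :=
  exist _ (bij_inv a (gfst p), bij_inv b (gsnd p)) (gunconj_subproof p).

Lemma gconjK f : cancel (@gconj f) (@gunconj f).
Proof. by move=> p; apply: gfst_inj; rewrite /gfst /= bijK. Qed.

Lemma gunconjK f : cancel (@gunconj f) (@gconj f).
Proof. by move=> p; apply: gfst_inj; rewrite /gfst /= bijVK. Qed.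

Lemma fprod_conj f : iso (fprod P Q f) (fprod P' Q' (bij_conj f)).
Proof.
apply/isoP; exists (mkbij (@gconjK f) (@gunconjK f)) => p q.
  by rewrite !mkbijE !lt1_mkdp /= b1.
by rewrite !mkbijE !lt2_mkdp /= a2.
Qed.

Lemma iprod_conj : iprod P Q = iprod P' Q'.
Proof.
rewrite [RHS](reindex bij_conj) /=; last first.
  by exists bij_unconj => f _; [apply: bij_conjK | apply: bij_unconjK].
rewrite [LHS](eq_bigl _ _ (fun f => esym (increasing_conj f))).
by apply: eq_bigr => f _; congr << _ >>; apply/clsP/fprod_conj.
Qed.

Lemma linext_conj n : @linext _ P n =1 @linext _ P' n.
Proof.
move=> s; apply/existsP/existsP=> -[w /andP[/forallP lw /increasingP iw]].
  exists (bij_comp (bij_sym a) w); apply/andP; split.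
    apply/forallP=> x; apply/forallP=> y; rewrite !bij_compE !bij_symE.
    rewrite -[x](bijVK a) -[y](bijVK a) a2 !bijK; exact: (forallP (lw _)).
  apply/increasingP=> x y; rewrite !bij_compE !bij_symE.
  rewrite -[x](bijVK a) -[y](bijVK a) a1 !bijK; exact: iw.
exists (bij_comp a w); apply/andP; split.
  apply/forallP=> x; apply/forallP=> y; rewrite !bij_compE -a2.
  exact: (forallP (lw _)).
by apply/increasingP=> x y; rewrite !bij_compE -a1; apply: iw.
Qed.

Lemma Lgen_conj : Lgen P = Lgen P'.
Proof.
rewrite /Lgen (bij_card a).
by apply: eq_bigl => s; apply: linext_conj.
Qed.

End Conj.
End WellDefined.

Lemma zelevinsky_cls (T U : finType) (P : sdposet T) (Q : sdposet U) :
  zelevinsky << cls P >> << cls Q >> = npictures P Q.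
Proof.
rewrite /zelevinsky /bilin !liftU !scale1r; congr Posz.
case/isoP: (rep_cls P) => a a1 a2; case/isoP: (rep_cls Q) => b b1 b2.
exact/esym/(npictures_conj a1 a2 b1 b2).
Qed.

Lemma zds_mul_cls (T U : finType) (P : sdposet T) (Q : sdposet U) :
  zds_mul << cls P >> << cls Q >> = iprod P Q.
Proof.
rewrite /zds_mul /bilin !liftU !scale1r.
case/isoP: (rep_cls P) => a a1 a2; case/isoP: (rep_cls Q) => b b1 b2.
exact/esym/(iprod_conj a1 a2 b1 b2).
Qed.

Lemma L_cls (T : finType) (P : sdposet T) : L << cls P >> = Lgen P.
Proof.
rewrite /L liftU scale1r; case/isoP: (rep_cls P) => a a1 a2.
exact/esym/(Lgen_conj a1 a2).
Qed.

(* Main.v *)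
From HB Require Import structures.
Require Import Defs.
From mathcomp Require Import all_boot all_order all_fingroup all_algebra.

Set Implicit Arguments.
Unset Strict Implicit.
Unset Printing Implicit Defensive.

Import GRing.Theory Defs.
Local Open Scope ring_scope.

(** Both identities are biadditive in x and y, so it suffices to check them on
    the classes of two special double posets P on T and Q on U.  If T and U have
    different cardinalities there is no bijection between them and every term
    vanishes.  Otherwise fix the labellings w : T -> 'I_n of P and
    v : U -> 'I_n of Q.  The permutations s of 'I_n correspond to the bijections
    f_s = v^-1 o s^-1 o w from T to U ([perm_to_bij]), and since v carries the
    second order of Q to the order of 'I_n,

    - f_s is increasing from (T, <_1) to (U, <_2) iff s is a linear extension of
      P ([linext_increasing]), and symmetrically f_s^-1 is increasing from
      (U, <_1) to (T, <_2) iff s^-1 is a linear extension of Q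
      ([linextV_increasing]).  So f_s is a picture exactly when the pair
      (s, s^-1) contributes to the scalar product of L(P) and L(Q).

    - The product of P and Q along f_s is U with its own first order and with
      the second order of P; read on U, its labelling is w o f_s^-1 = s o v.
      Thus r is a linear extension of it iff r^-1 o s o v is increasing, i.e.
      iff r = s o t with t a linear extension of Q ([linext_fprod]).  Summing
      over all linear extensions s of P gives L(P) o L(Q). *)

(** * Linear maps on free modules *)

Lemma additive_ext (K : choiceType) (M : zmodType) (F G : {freeg K / int} -> M) :
    zmod_morphism F -> zmod_morphism G -> (forall k, F << k >> = G << k >>) -> F =1 G.
Proof.
move=> addF addG eqFG.
pose F' : {additive _ -> _} := HB.pack F (GRing.isZmodMorphism.Build _ _ F addF).
pose G' : {additive _ -> _} := HB.pack G (GRing.isZmodMorphism.Build _ _ G addG).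
move=> x; change (F' x = G' x); elim/freeg_ind_dom0: x => [|a k D _ _ IH].
  by rewrite !raddf0.
rewrite !raddfD IH; congr (_ + _).
by rewrite -[a]intz -freegU_mulz !raddfMz /= eqFG.
Qed.

HB.instance Definition _ (K : choiceType) (M : lmodType int) (f : K -> M) :=
  GRing.isZmodMorphism.Build {freeg K / int} M (fglift f) (lift_is_additive f).

Section Bilinear.
Variables (K1 K2 : choiceType) (M : lmodType int) (f : K1 -> K2 -> M).

Lemma bilin_additivel y : zmod_morphism (bilin f ^~ y).
Proof. exact: lift_is_additive. Qed.

Lemma bilin_additiver x : zmod_morphism (bilin f x).
Proof.
move=> y z; move: x; apply: additive_ext => [||k].
- exact: bilin_additivel.
- move=> x x1 /=; rewrite !bilin_additivel !opprB addrACA [RHS]addrACA.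
  by congr (_ + _); apply: addrC.
- by rewrite /bilin !liftU !scale1r lift_is_additive.
Qed.

Lemma bilin_sum (I J : finType) (A : pred I) (B : pred J) a b :
  bilin f (\sum_(i | A i) << a i >>) (\sum_(j | B j) << b j >>)
  = \sum_(i | A i) \sum_(j | B j) f (a i) (b j).
Proof.
rewrite /bilin raddf_sum; apply: eq_bigr => i _ /=.
rewrite liftU scale1r raddf_sum; apply: eq_bigr => j _ /=.
by rewrite liftU scale1r.
Qed.

End Bilinear.

Lemma L_additive : zmod_morphism L.
Proof. exact: lift_is_additive. Qed.

HB.instance Definition _ := GRing.isZmodMorphism.Build ZDS ZS L L_additive.

(** Since every class has a representative, an identity between biadditive maps
    on [ZDS] can be checked on pairs of special double posets. *)
Lemma ZDS_biadditive_ext (M : zmodType) (F G : ZDS -> ZDS -> M) :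
    (forall y, zmod_morphism (F ^~ y)) -> (forall x, zmod_morphism (F x)) ->
    (forall y, zmod_morphism (G ^~ y)) -> (forall x, zmod_morphism (G x)) ->
    (forall (T U : finType) (P : sdposet T) (Q : sdposet U),
       F << cls P >> << cls Q >> = G << cls P >> << cls Q >>) ->
  forall x y, F x y = G x y.
Proof.
move=> Fl Fr Gl Gr FG x y; move: x; apply: additive_ext => // c.
move: y; apply: additive_ext => // d.
by rewrite -[c]repK -[d]repK; apply: FG.
Qed.

(** * Linear extensions as increasing bijections *)

Lemma is_labellingE (T : finType) (P : sdposet T) n (w : bij T 'I_n) x y :
  is_labelling P w -> lt2 P x y = (w x < w y)%N.
Proof. by move=> /forallP/(_ x)/forallP/(_ y)/eqP. Qed.

Lemma labelling_exists_card (T : finType) (P : sdposet T) n :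
  #|T| = n -> exists w : bij T 'I_n, is_labelling P w.
Proof. by move=> <-; apply: labelling_exists. Qed.

Lemma Lgen_card (T : finType) (P : sdposet T) n :
  #|T| = n -> Lgen P = \sum_(s : 'S_n | linext P s) << permT s >>.
Proof. by move=> <-. Qed.

Lemma linextE (T : finType) (P : sdposet T) n (w : bij T 'I_n) (s : 'S_n) :
    is_labelling P w ->
  linext P s = increasing (lt1 P) (fun i j : 'I_n => (i < j)%N)
                 (fun x => s^-1%g (w x)).
Proof.
move=> lw; apply/existsP/idP => [[w' /andP[lw']]|incr].
  by rewrite (labelling_uniq lw' lw).
by exists w; rewrite lw.
Qed.

Section PermToBij.
Variables (T U : finType) (n : nat) (w : bij T 'I_n) (v : bij U 'I_n).

(** The inverse of s appears because a linear extension s of P is tested through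
    s^-1 o w; after composing with v^-1, the test becomes monotonicity of a map
    from T to U. *)
Definition perm_to_bij (s : 'S_n) : bij T U :=
  bij_comp w (bij_comp (mkbij (permKV s) (permK s)) (bij_sym v)).

Lemma perm_to_bijE s x : v (perm_to_bij s x) = s^-1%g (w x).
Proof. by rewrite !bij_compE mkbijE bij_symE bijVK. Qed.

Lemma perm_to_bijVE s y : w (bij_inv (perm_to_bij s) y) = s (v y).
Proof. by apply: (canRL (permKV s)); rewrite -perm_to_bijE bijVK. Qed.

Lemma perm_to_bij_bijective : bijective perm_to_bij.
Proof.
have inj (f : bij T U) : injective (fun i => w (bij_inv f (bij_inv v i))).
  by apply: (@can_inj _ _ _ (fun i => v (f (bij_inv w i)))) => i; rewrite bijK !bijVK.
exists (fun f => perm (inj f)) => [s|f].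
  by apply/permP=> i; rewrite permE perm_to_bijVE bijVK.
apply: bij_ext => x; apply: (@bij_inj _ _ v); rewrite perm_to_bijE.
by apply: (canLR (permK _)); rewrite permE !bijK.
Qed.

End PermToBij.

Section TwoPosets.
Variables (T U : finType) (P : sdposet T) (Q : sdposet U).
Variables (n : nat) (w : bij T 'I_n) (v : bij U 'I_n).
Hypotheses (lw : is_labelling P w) (lv : is_labelling Q v).

Let bij_of := perm_to_bij w v.

Lemma linext_increasing s :
  linext P s = increasing (lt1 P) (lt2 Q) (bij_of s).
Proof.
rewrite (linextE s lw); apply/increasingP/increasingP => h x y /h;
by rewrite (is_labellingE _ _ lv) !perm_to_bijE.
Qed.

Lemma linextV_increasing s :
  linext Q s^-1%g = increasing (lt1 Q) (lt2 P) (bij_inv (bij_of s)).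
Proof.
rewrite (linextE _ lv) invgK; apply/increasingP/increasingP => h x y /h;
by rewrite (is_labellingE _ _ lw) !perm_to_bijVE.
Qed.

Lemma npictures_linext :
  npictures P Q = #|[set s : 'S_n | linext P s && linext Q s^-1%g]|.
Proof.
have [g /can_inj inj gK] := perm_to_bij_bijective w v.
rewrite /npictures -(card_imset _ inj); apply: eq_card => f.
rewrite -[f]gK mem_imset ?inE //.
by rewrite /is_picture linext_increasing linextV_increasing.
Qed.

Definition graph_bij (f : bij T U) : bij (graph_of f) T.
Proof.
refine (@mkbij _ _ (@gfst T U f) (fun x => exist _ (x, f x) (eqxx _)) _ _) => //.
by move=> p; apply: gfst_inj.
Defined.

(** The factor s cancels the bijection: (s o t)^-1 o w = t^-1 o v o f_s on T, and
    f_s sends the first component of a point of the graph to the second one, on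
    which the first order of the product is that of Q.  The product (t * s)
    applies t before s. *)
Lemma linext_fprod s t : linext (fprod P Q (bij_of s)) (t * s)%g = linext Q t.
Proof.
have lG : is_labelling (fprod P Q (bij_of s)) (bij_comp (graph_bij (bij_of s)) w).
  apply/forallP=> p; apply/forallP=> q.
  by rewrite !bij_compE !mkbijE lt2_mkdp /= (is_labellingE _ _ lw).
have key p : (t * s)^-1%g (bij_comp (graph_bij (bij_of s)) w p)
             = t^-1%g (v (gsnd p)).
  by rewrite gsndE perm_to_bijE bij_compE mkbijE invMg permM.
rewrite (linextE _ lG) (linextE _ lv).
apply/increasingP/increasingP=> h x y; last by rewrite !key lt1_mkdp; apply: h.
pose p z : graph_of (bij_of s) :=
  bij_inv (graph_bij (bij_of s)) (bij_inv (bij_of s) z).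
have pE z : gsnd (p z) = z.
  by rewrite gsndE /p mkbijVE /gfst /= bijVK.
by move: (h (p x) (p y)); rewrite !key lt1_mkdp /= !pE.
Qed.

End TwoPosets.

(** * The two identities on generators *)

(** A permutation and its inverse have the same size, so both sides vanish when
    T and U have different cardinalities.  Otherwise each linear extension s of
    P pairs only with s^-1, and the total counts the pictures. *)
Lemma jollenbeck_Lgen (T U : finType) (P : sdposet T) (Q : sdposet U) :
  jollenbeck (Lgen P) (Lgen Q) = (npictures P Q)%:Z.
Proof.
case: (eqVneq #|T| #|U|) => [TU|neqTU]; rewrite /jollenbeck; last first.
  rewrite bilin_sum big1 => [|s _]; last first.
    rewrite big1 // => t _; case: eqP => // /(congr1 tag) /= TU.
    by rewrite TU eqxx in neqTU.
  apply/esym/eqP; rewrite eqz_nat cards_eq0; apply/eqP/setP => f.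
  by rewrite (bij_card f) eqxx in neqTU.
rewrite (Lgen_card P TU) bilin_sum.
have [w lw] := labelling_exists_card P TU; have [v lv] := labelling_exists Q.
rewrite (npictures_linext lw lv) -sum1_card -[Posz _]natz natr_sum.
under [RHS]eq_bigl do rewrite inE.
rewrite [RHS]big_mkcondr; apply: eq_bigr => s _.
rewrite big_mkcond (bigD1 s^-1%g) //= invgK eqxx big1 ?addr0 // => t ne_t.
case: ifP => // _; rewrite eq_Tagged /= -[s in s == _]invgK (inj_eq invg_inj).
by rewrite eq_sym (negbTE ne_t).
Qed.

(** The increasing bijections are the f_s for s a linear extension of P, and
    the linear extensions of the product along f_s are the s o t for t a linear
    extension of Q: both sides are the same double sum over (s, t). *)
Lemma L_iprod (T U : finType) (P : sdposet T) (Q : sdposet U) :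
  L (iprod P Q) = zs_mul (Lgen P) (Lgen Q).
Proof.
rewrite raddf_sum /=; under eq_bigr do rewrite L_cls.
case: (eqVneq #|T| #|U|) => [TU|neqTU]; rewrite /zs_mul; last first.
  rewrite bilin_sum !big1 // => [s _|f _].
    by rewrite big1 // => t _; rewrite /perm_comp /= (negbTE neqTU).
  by rewrite (bij_card f) eqxx in neqTU.
rewrite (Lgen_card P TU) bilin_sum.
have [w lw] := labelling_exists_card P TU; have [v lv] := labelling_exists Q.
rewrite (reindex (perm_to_bij w v)) /=; last exact/onW_bij/perm_to_bij_bijective.
apply: eq_big => [s|s _]; first by rewrite -(linext_increasing lw lv).
rewrite (Lgen_card _ (etrans (bij_card (graph_bij _)) TU)).
rewrite (reindex_inj (mulIg s)) /=.
apply: eq_big => [t|t _]; first exact: linext_fprod.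
by rewrite /perm_comp /= eqxx tagged_asE.
Qed.

Theorem theorem3p2 :
  forall x y : ZDS,
    zelevinsky x y = jollenbeck (L x) (L y) /\ L (zds_mul x y) = zs_mul (L x) (L y).
Proof.
move=> x y; split.
- move: x y; apply: (@ZDS_biadditive_ext int) => [y|x|y x x'|x y y'|T U P Q].
  + exact: (@bilin_additivel _ _ int^o).
  + exact: (@bilin_additiver _ _ int^o).
  + by rewrite L_additive [LHS]bilin_additivel.
  + by rewrite L_additive [LHS]bilin_additiver.
  + by rewrite zelevinsky_cls !L_cls jollenbeck_Lgen.
- move: x y.
  apply: ZDS_biadditive_ext => [y x x'|x y y'|y x x'|x y y'|T U P Q].
  + by rewrite [zds_mul _ _]bilin_additivel L_additive.
  + by rewrite [zds_mul _ _]bilin_additiver L_additive.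
  + by rewrite L_additive [LHS]bilin_additivel.
  + by rewrite L_additive [LHS]bilin_additiver.
  + by rewrite zds_mul_cls !L_cls L_iprod.
Qed.
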